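(* Given a finite reduced dependency space of an existential PBES $\mathcal{E}$ (i.e., the quotient graph $G/{\sim_G}$ has finitely many vertices for some feasible pair $\langle{\sim}_D,{\sim}_B\rangle$), the membership problem of $\mathcal{E}$ is decidable.
   Context: A PBES is a sequence of equations $\sigma_i X_i(\vec d{:}\vec D)=\varphi_i$ ($1\le i\le n$) with $\sigma_i\in\{\mu,\nu\}$ (least/greatest fixed point); its solution $[\![\mathcal{E}]\!]$ maps each bound predicate variable $X_i$ to a predicate $\mathbb{D}^*\to\mathbb{B}$, where $\mathbb{B}=\{\mathrm{true},\mathrm{false}\}$. The membership problem asks, for given $X$ and $\vec v\in\mathbb{D}^*$, whether $[\![\mathcal{E}]\!](X)(\vec v)=\mathrm{true}$. An existential PBES (no universal quantifiers) can be assumed to be of the form $\sigma_i X_i(\vec d{:}\vec D)=\bigvee_{1\le k\le m_i}\exists \vec e{:}\vec D\ \varphi_{ik}(\vec d,\vec e)\wedge X_{a_{ik1}}(\vec f_{ik1}(\vec d,\vec e))\wedge\dots\wedge X_{a_{ikp_{ik}}}(\vec f_{ikp_{ik}}(\vec d,\vec e))$ with Boolean expressions $\varphi_{ik}$ and data expressions $\vec f_{ikj}$. Its dependency space is the graph with $\vee$-vertices $X_i(\vec v)$ (elements of $\mathrm{sig}(\mathcal{E})=\{(X_i,\vec v)\}$) and $\wedge$-vertices $(i,k,\vec v,\vec w)\in B=\mathbb{N}\times\mathbb{N}\times\mathbb{D}^*\times\mathbb{D}^*$, with edges $X_i(\vec v)\to(i,k,\vec v,\vec w)$ and $(i,k,\vec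 v,\vec w)\to X_{a_{ikj}}(\vec f_{ikj}(\vec v,\vec w))$ for all $j$, whenever $\varphi_{ik}(\vec v,\vec w)$ holds. Define $F_{ik}(X_j(\vec v))=\{(i,k,\vec v,\vec w)\mid\varphi_{ik}(\vec v,\vec w)\}$ if $i=j$ and $\emptyset$ otherwise; $G_{ik}(j,k',\vec v,\vec w)=\{X_{a_{ikj'}}(\vec f_{ikj'}(\vec v,\vec w))\mid 1\le j'\le p_{ik}\}$ if $i=j,k=k'$ and $\emptyset$ otherwise. A pair of equivalences ${\sim}_D$ on $\mathrm{sig}(\mathcal{E})$ and ${\sim}_B$ on $B$ is feasible if: $X_i(\vec v)\not\sim_D X_j(\vec v')$ for $i\ne j$; $X_i(\vec v)\sim_D X_i(\vec v')$ implies $F_{ik}(X_i(\vec v))\sim_B F_{ik}(X_i(\vec v'))$ for all $k$; $(i,k,\vec v,\vec w)\not\sim_B(j,k',\vec v',\vec w')$ if $i\ne j$ or $k\ne k'$; and $(i,k,\vec v,\vec w)\sim_B(i,k,\vec v',\vec w')$ implies $G_{ik}(i,k,\vec v,\vec w)\sim_D G_{ik}(i,k,\vec v',\vec w')$, where for sets $\alpha\sim\beta$ iff $\{[a]\mid a\in\alpha\}=\{[b]\mid b\in\beta\}$. With ${\sim_G}={\sim_D}\cup{\sim_B}$, the reduced dependency space is the quotient graph on $V/{\sim_G}$ with edges $([v],[w])$ for each edge $(v,w)$, and $\vee/\wedge$ labels inherited.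
   Formalization: Adds that the class of X(v) in the given space is computable from (X,v), else a feasible pair with three classes can encode the halting problem; B is limited to indices (i,k) of actual clauses, since with all of N×N the quotient is never finite. *)

(* Defs.v *)
(* MathComp, with the classical sets of MathComp-Analysis. *)
From mathcomp Require Import all_boot.
From mathcomp Require Import boolp classical_sets.
Set Implicit Arguments.
Unset Strict Implicit.
Unset Printing Implicit Defensive.
Local Open Scope classical_set_scope.
Local Open Scope quotient_scope.

(* Total recursive functions: closure under minimisation is only required for
   regular functions, i.e. those for which a zero always exists. *)
Inductive recursive : forall n : nat, (n.-tuple nat -> nat) -> Prop :=
| rec_zero n : recursive (fun _ : n.-tuple nat => 0)
| rec_succ : recursive (fun t : 1.-tuple nat => (tnth t ord0).+1)
| rec_proj n (i : 'I_n) : recursive (fun t : n.-tuple nat => tnth t i)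
| rec_comp m n (f : m.-tuple nat -> nat) (g : 'I_m -> n.-tuple nat -> nat) :
    recursive f -> (forall i, recursive (g i)) ->
    recursive (fun t : n.-tuple nat => f [tuple g i t | i < m])
| rec_prim n (f : n.-tuple nat -> nat) (g : n.+2.-tuple nat -> nat) :
    recursive f -> recursive g ->
    recursive (fun t : n.+1.-tuple nat =>
      iteri (thead t) (fun k r => g [tuple of k :: r :: behead t])
        (f [tuple of behead t]))
| rec_mu n (f : n.+1.-tuple nat -> nat)
    (reg : forall t : n.-tuple nat, exists y, f [tuple of y :: t] == 0) :
    recursive f -> recursive (fun t : n.-tuple nat => ex_minn (reg t))
| rec_ext n (f g : n.-tuple nat -> nat) :
    f =1 g -> recursive f -> recursive g.

Definition recursive1 (f : nat -> nat) : Prop :=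
  recursive (fun t : 1.-tuple nat => f (tnth t ord0)).

Definition recursive2 (f : nat -> nat -> nat) : Prop :=
  recursive (fun t : 2.-tuple nat => f (tnth t ord0) (tnth t ord_max)).

(* [h] is a decision procedure for the problem [P], whose instances [a : A]
   are input through their codes [pickle a]. *)
Definition decides (A : countType) (h : nat -> nat) (P : A -> Prop) : Prop :=
  recursive1 h /\
  forall a, (P a -> h (pickle a) = 1) /\ (~ P a -> h (pickle a) = 0).

(* An existential PBES over the set [T] of data vectors (any countable set:
   tuples, finite sequences, ...)
     sigma_i X_i(d) =
       \/_k exists e, phi_ik(d,e) /\ X_{a_ik1}(f_ik1(d,e)) /\ ...
   where i ranges over ['I_(nvar E)], k over ['I_(nclause i)] and the atoms of
   the clause ik over ['I_(natom (Tagged _ k))].  Boolean and data expressions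
   are represented by the functions that they denote. *)
Record epbes (T : Type) := EPBES {
  nvar : nat;
  isnu : 'I_nvar -> bool; (* true if sigma_i = nu, false if sigma_i = mu *)
  nclause : 'I_nvar -> nat;
  natom : {i : 'I_nvar & 'I_(nclause i)} -> nat;
  guard : {i : 'I_nvar & 'I_(nclause i)} -> T -> T -> bool;
  target : forall c, 'I_(natom c) -> 'I_nvar;
  arg : forall c, 'I_(natom c) -> T -> T -> T
}.

Notation clause E := {i : 'I_(nvar E) & 'I_(nclause i)}.

Section Semantics.
Variables (T : Type) (E : epbes T).

Definition env := 'I_(nvar E) -> set T.

Definition upd (eta : env) (i : 'I_(nvar E)) (P : set T) : env :=
  fun j => if j == i then P else eta j.

Definition rhs (i : 'I_(nvar E)) (eta : env) : set T :=
  [set d | exists (k : 'I_(nclause i)) (e : T),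
    let c : clause E := Tagged _ k in
    guard c d e /\ forall j : 'I_(natom c), eta (target j) (arg j d e)].

Definition lfp (F : set T -> set T) : set T :=
  \bigcap_(P in [set P | F P `<=` P]) P.

Definition gfp (F : set T -> set T) : set T :=
  \bigcup_(P in [set P | P `<=` F P]) P.

(* The equations are solved in their order of appearance, the first being the
   outermost fixed point:
     [[(sigma X = phi) s]] eta = [[s]] (eta[X := sigma P. phi([[s]] eta[X := P])]) *)
Fixpoint solve_eqs (s : seq 'I_(nvar E)) (eta : env) : env :=
  if s is i :: s' then
    let F P := rhs i (solve_eqs s' (upd eta i P)) in
    solve_eqs s' (upd eta i (if isnu i then gfp F else lfp F))
  else eta.

(* The initial environment is irrelevant since all variables are bound. *)
Definition solution : env := solve_eqs (enum 'I_(nvar E)) (fun=> set0).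

Definition membership (q : 'I_(nvar E) * T) : Prop := solution q.1 q.2.

End Semantics.

Section DependencySpace.
Variables (T : countType) (E : epbes T).

(* sig(E): the pair (i, v) stands for X_i(v). *)
Definition orv : countType := ('I_(nvar E) * T)%type.

(* B, restricted to the pairs (i, k) that index a clause of E; the triple
   (c, v, w) with c = Tagged _ k and tag c = i stands for (i, k, v, w). *)
Definition andv : countType := (clause E * T * T)%type.

Definition vertex : countType := (orv + andv)%type.

Definition edge (x y : vertex) : Prop :=
  match x, y with
  | inl (i, v), inr (c, v', w) => [/\ tag c = i, v' = v & guard c v w]
  | inr (c, v, w), inl q =>
      guard c v w /\ exists j : 'I_(natom c), q = (target j, arg j v w)
  | _, _ => False
  end.

(* [Some i] for a \/-vertex X_i(v), [None] for a /\-vertex. *)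
Definition label (x : vertex) : option nat :=
  if x is inl (i, _) then Some (val i) else None.

Definition Fset (c : clause E) (q : orv) : set andv :=
  [set b | tag c = q.1 /\ exists w, guard c q.2 w /\ b = (c, q.2, w)].

Definition Gset (c : clause E) (b : andv) : set orv :=
  let: (c', v, w) := b in
  [set q | c = c' /\ exists j : 'I_(natom c), q = (target j, arg j v w)].

(* The lifting to sets: {[a] | a in X} = {[b] | b in Y}. *)
Definition set_equiv (A : choiceType) (e : equiv_rel A) (X Y : set A) : Prop :=
  [set \pi_{eq_quot e} a | a in X] = [set \pi_{eq_quot e} b | b in Y].

Definition feasible (simD : equiv_rel orv) (simB : equiv_rel andv) : Prop :=
  [/\ forall i j v v', i <> j -> ~ simD (i, v) (j, v'),
      forall i v v', simD (i, v) (i, v') -> forall k : 'I_(nclause i),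
        set_equiv simB (Fset (Tagged _ k) (i, v)) (Fset (Tagged _ k) (i, v')),
      forall (c c' : clause E) v w v' w',
        c <> c' -> ~ simB (c, v, w) (c', v', w')
    & forall (c : clause E) v w v' w', simB (c, v, w) (c, v', w') ->
        set_equiv simD (Gset c (c, v, w)) (Gset c (c, v', w'))].

Section Reduced.
Variables (simD : equiv_rel orv) (simB : equiv_rel andv).

Definition simG_rel : rel vertex := fun x y =>
  match x, y with
  | inl q, inl q' => simD q q'
  | inr b, inr b' => simB b b'
  | _, _ => false
  end.

Lemma simG_refl : reflexive simG_rel.
Proof. by case=> x /=; exact: equiv_refl. Qed.

Lemma simG_sym : symmetric simG_rel.
Proof. by case=> x [] y //=; exact: equiv_sym. Qed.

Lemma simG_trans : transitive simG_rel.
Proof. by case=> y [] x [] z //=; exact: equiv_trans. Qed.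

Canonical simG : equiv_rel vertex :=
  EquivRel simG_rel simG_refl simG_sym simG_trans.

Definition rvertex := {eq_quot simG}.

Definition redge (a b : rvertex) : Prop :=
  exists x y, [/\ edge x y, \pi_rvertex x = a & \pi_rvertex y = b].

End Reduced.

End DependencySpace.

(* A finite reduced dependency space as concrete data, with vertices numbered
   from 0: the fixed-point signs of X_0, X_1, ... (true for nu), the labels of
   the vertices, and the edges. *)
Definition finspace : countType :=
  (seq bool * seq (option nat) * seq (nat * nat))%type.

Definition fs_isnu (S : finspace) : seq bool := S.1.1.
Definition fs_label (S : finspace) : seq (option nat) := S.1.2.
Definition fs_edges (S : finspace) : seq (nat * nat) := S.2.

(* [S] is the reduced dependency space of [E] for (simD, simB), in which the
   vertex [a] of the quotient graph bears the number [num a]; in particular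
   the quotient graph has [size (fs_label S)] vertices. *)
Definition represents (T : countType) (E : epbes T)
    (simD : equiv_rel (orv E)) (simB : equiv_rel (andv E))
    (S : finspace) (num : rvertex simD simB -> nat) : Prop :=
  [/\ injective num,
      range num = [set m | m < size (fs_label S)],
      fs_isnu S = [seq isnu i | i <- enum 'I_(nvar E)],
      forall x : vertex E,
        nth None (fs_label S) (num (\pi_(rvertex simD simB) x)) = label x
    & forall m m', (m, m') \in fs_edges S <->
        exists a b, [/\ redge a b, num a = m & num b = m']].

(* Main.v *)
(* In a saturated environment, whether X_i(v) satisfies the right-hand side of
   its equation depends only on the class of X_i(v) and is read off the edges
   of the reduced dependency space.  Hence saturated environments correspond
   to sets of vertices of this finite graph, and every fixed point involved in
   the solution is the last term of a monotone chain of saturated sets, which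
   is stationary after as many steps as there are vertices.  The nested
   iteration computing the solution is primitive recursive: the value of the
   last j equations, as a function of the environment, is tabulated over the
   finitely many environments, and the tables are computed by recursion on j. *)
Require Import Defs.
From mathcomp Require Import all_boot.
From mathcomp Require Import boolp classical_sets.
Local Open Scope quotient_scope.

Set Implicit Arguments.
Unset Strict Implicit.
Unset Printing Implicit Defensive.

(** * Recursive functions *)

(* Sequences rather than tuples as environments: variables are then iterated
   heads and tails, whatever the arity. *)
Definition crec n (F : seq nat -> nat) := recursive (fun t : n.-tuple nat => F t).

Lemma crec_ext n F G : (forall s, size s = n -> F s = G s) -> crec n F -> crec n G.
Proof. by move=> FG; apply: rec_ext => t; rewrite FG ?size_tuple. Qed.

Lemma crec_comp n f (gs : seq (seq nat -> nat)) :
    crec (size gs) f -> (forall i, i < size gs -> crec n (nth (fun=> 0) gs i)) ->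
  crec n (fun s => f [seq g s | g <- gs]).
Proof.
move=> fR gR; have giR (i : 'I_(size gs)) := gR i (ltn_ord i).
apply: rec_ext (rec_comp fR giR) => t /=; congr f.
by rewrite -[in RHS](mkseq_nth (fun=> 0) gs) /mkseq -map_comp -val_enum_ord -map_comp.
Qed.

Lemma crec_const n c : crec n (fun=> c).
Proof.
elim: c => [|c IHc]; first exact: rec_zero.
by apply: rec_ext (rec_comp rec_succ (fun=> IHc)) => t; rewrite tnth_mktuple.
Qed.

Lemma crec_nth n i : crec n (fun s => nth 0 s i).
Proof.
have [lt_in | le_ni] := ltnP i n.
  apply: rec_ext (rec_proj (Ordinal lt_in)) => t.
  by rewrite (tnth_nth 0).
by apply: crec_ext (crec_const n 0) => s sz_s; rewrite nth_default // sz_s.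
Qed.

Lemma crec_var n i : crec n (fun s => head 0 (iter i behead s)).
Proof.
apply: crec_ext (crec_nth n i) => s _; rewrite -nth0.
elim: i s => // i IHi [|x s] /=; last by rewrite -iterS iterSr /= -IHi.
by rewrite -iterS iterSr /= -IHi nth_nil.
Qed.

(** [rec_prim] iterates over its first argument and passes the others on, so it is composed with [h]
    followed by the n projections: the step sees the counter, the accumulator and the unchanged
    environment. *)
Lemma crec_iteri n h f (G : nat -> nat -> seq nat -> nat) :
    crec n h -> crec n f ->
    crec n.+2 (fun s => G (head 0 s) (head 0 (behead s)) (behead (behead s))) ->
  crec n (fun s => iteri (h s) (fun k r => G k r s) (f s)).
Proof.
move=> hR fR /(rec_prim fR) GR; pose gs := h :: [seq (nth 0)^~ i | i <- iota 0 n].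
pose it s := iteri (head 0 s) (fun k r => G k r (behead s)) (f (behead s)).
have size_gs : size gs = n.+1 by rewrite /= size_map size_iota.
have itR : crec (size gs) it.
  by rewrite size_gs; apply: rec_ext GR => -[[|x s] ?]; rewrite /thead (tnth_nth 0).
apply: crec_ext (crec_comp itR (_ : forall i, _ -> crec n _)) => [s sz_s | [|i]] //=.
  by rewrite -map_comp map_nth_iota0 ?sz_s // -sz_s take_size.
rewrite size_map size_iota ltnS => lt_in.
rewrite (nth_map 0) ?size_iota // nth_iota //; exact: crec_nth.
Qed.

(** Closure under composition at every arity, so that an expression is shown recursive by following
    its syntax. *)
Definition crec1 (h : nat -> nat) := forall n f, crec n f -> crec n (fun s => h (f s)).
Definition crec2 (h : nat -> nat -> nat) :=
  forall n f1 f2, crec n f1 -> crec n f2 -> crec n (fun s => h (f1 s) (f2 s)).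
Definition crec3 (h : nat -> nat -> nat -> nat) :=
  forall n f1 f2 f3, crec n f1 -> crec n f2 -> crec n f3 ->
  crec n (fun s => h (f1 s) (f2 s) (f3 s)).
Definition crec4 (h : nat -> nat -> nat -> nat -> nat) :=
  forall n f1 f2 f3 f4, crec n f1 -> crec n f2 -> crec n f3 -> crec n f4 ->
  crec n (fun s => h (f1 s) (f2 s) (f3 s) (f4 s)).

Notation x0 s := (head 0 s).
Notation x1 s := (head 0 (behead s)).
Notation x2 s := (head 0 (behead (behead s))).
Notation x3 s := (head 0 (behead (behead (behead s)))).

Lemma crec1I h : crec 1 (fun s => h (x0 s)) -> crec1 h.
Proof. by move=> hR n f fR; apply: (@crec_comp n _ [:: f]) hR _ => -[|[]]. Qed.

Lemma crec2I h : crec 2 (fun s => h (x0 s) (x1 s)) -> crec2 h.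
Proof.
by move=> hR n f1 f2 *; apply: (@crec_comp n _ [:: f1; f2]) hR _ => -[|[|[]]].
Qed.

Lemma crec3I h : crec 3 (fun s => h (x0 s) (x1 s) (x2 s)) -> crec3 h.
Proof.
move=> hR n f1 f2 f3 *.
by apply: (@crec_comp n _ [:: f1; f2; f3]) hR _ => -[|[|[|[]]]].
Qed.

Lemma crec4I h : crec 4 (fun s => h (x0 s) (x1 s) (x2 s) (x3 s)) -> crec4 h.
Proof.
move=> hR n f1 f2 f3 f4 *.
by apply: (@crec_comp n _ [:: f1; f2; f3; f4]) hR _ => -[|[|[|[|[]]]]].
Qed.

Lemma recursive1_crec1 h : recursive1 h -> crec1 h.
Proof. by move=> hR; apply/crec1I; apply: rec_ext hR => t; rewrite (tnth_nth 0) nth0. Qed.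

Lemma crec1_recursive1 h : crec1 h -> recursive1 h.
Proof.
move=> hR; apply: rec_ext (hR _ _ (crec_var 1 0)) => t.
by rewrite (tnth_nth 0) nth0.
Qed.

Lemma crec2_recursive2 h : crec2 h -> recursive2 h.
Proof.
move=> hR; apply: rec_ext (hR _ _ _ (crec_var 2 0) (crec_var 2 1)) => t.
by case: t => -[|a [|b []]] // ?; rewrite !(tnth_nth 0).
Qed.

(** * Arithmetic and Boolean operations *)

Lemma succR : crec1 S.
Proof. by apply/crec1I; apply: rec_ext rec_succ => t; rewrite (tnth_nth 0) nth0. Qed.

Ltac var := first [exact: (crec_var _ 0) | exact: (crec_var _ 1)
  | exact: (crec_var _ 2) | exact: (crec_var _ 3) | exact: (crec_var _ 4)
  | exact: (crec_var _ 5) | exact: (crec_var _ 6) | exact: (crec_var _ 7)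
  | exact: (crec_var _ 8) | exact: (crec_var _ 9) | exact: (crec_var _ 10)].

Lemma addR : crec2 addn.
Proof.
apply/crec2I/(crec_ext (F := fun s => iteri (x0 s) (fun _ r => r.+1) (x1 s))) => [s _|].
  by elim: (x0 s) => //= k ->.
apply: crec_iteri; [var | var | apply: succR; var].
Qed.

Lemma predR : crec1 predn.
Proof.
apply/crec1I/(crec_ext (F := fun s => iteri (x0 s) (fun k _ => k) 0)) => [s _|].
  by case: (x0 s).
apply: crec_iteri; [var | exact: crec_const | var].
Qed.

Lemma mulR : crec2 muln.
Proof.
apply/crec2I/(crec_ext (F := fun s => iteri (x0 s) (fun _ r => x1 s + r) 0)) => [s _|].
  by elim: (x0 s) => //= k ->.
apply: crec_iteri; [var | exact: crec_const | apply: addR; var].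
Qed.

Lemma subR : crec2 subn.
Proof.
apply/crec2I/(crec_ext (F := fun s => iteri (x1 s) (fun _ r => r.-1) (x0 s))) => [s _|].
  by elim: (x1 s) => [|k /= ->]; rewrite ?subn0 ?subnS.
apply: crec_iteri; [var | var | apply: predR; var].
Qed.

Lemma expR : crec2 expn.
Proof.
apply/crec2I/(crec_ext (F := fun s => iteri (x1 s) (fun _ r => x0 s * r) 1)) => [s _|].
  by elim: (x1 s) => [|k /= ->] //; rewrite expnS.
apply: crec_iteri; [var | exact: crec_const | apply: mulR; var].
Qed.

Lemma eq0R : crec1 (fun m => m == 0).
Proof.
move=> n f fR; apply: (crec_ext (F := fun s => 1 - f s)) => [s _|].
  by case: (f s).
by apply: subR fR; apply: crec_const.
Qed.

Lemma leqR : crec2 leq.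
Proof. by move=> n f g fR gR; apply/eq0R/subR. Qed.

Lemma ltnR : crec2 (fun m n => m < n).
Proof. by move=> n f g fR gR; apply/leqR/gR/succR. Qed.

Lemma negbR n (p : seq nat -> bool) : crec n p -> crec n (fun s => ~~ p s).
Proof. by move=> pR; apply: crec_ext (eq0R pR) => s _; case: (p s). Qed.

Lemma andbR n (p q : seq nat -> bool) :
  crec n p -> crec n q -> crec n (fun s => p s && q s).
Proof.
by move=> pR qR; apply: crec_ext (mulR pR qR) => s _; rewrite mulnb.
Qed.

Lemma implybR n (p q : seq nat -> bool) :
  crec n p -> crec n q -> crec n (fun s => p s ==> q s).
Proof.
move=> pR /negbR/(andbR pR)/negbR; apply: crec_ext => s _.
by case: (p s); case: (q s).
Qed.

Lemma eqnR : crec2 (fun m n => m == n).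
Proof.
move=> n f g fR gR; apply: crec_ext (andbR (leqR fR gR) (leqR gR fR)) => s _.
by rewrite eqn_leq.
Qed.

Lemma ifR n (p : seq nat -> bool) f g : crec n p -> crec n f -> crec n g ->
  crec n (fun s => if p s then f s else g s).
Proof.
move=> pR fR gR.
apply: crec_ext (addR (mulR pR fR) (mulR (negbR pR) gR)) => s _.
by case: (p s); rewrite !(mul1n, mul0n, addn0).
Qed.

(** * Bounded sums and quantifiers *)

Definition bsum n (f : nat -> nat) := iteri n (fun k r => f k + r) 0.

Lemma bsumE n f : bsum n f = \sum_(k < n) f k.
Proof.
elim: n => [|n IHn]; first by rewrite big_ord0.
by rewrite big_ord_recr /= -IHn addnC.
Qed.

Lemma bsumR n h (f : nat -> seq nat -> nat) :
  crec n h -> crec n.+2 (fun s => f (x0 s) (behead (behead s))) ->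
  crec n (fun s => bsum (h s) (fun k => f k s)).
Proof.
move=> hR fR; apply: (@crec_iteri n h (fun=> 0) (fun k r s => f k s + r)) => //.
  exact: crec_const.
by apply: addR => //; var.
Qed.

Definition bex n (p : nat -> bool) := 0 < bsum n p.

Lemma bexP n (p : nat -> bool) : reflect (exists2 k, k < n & p k) (bex n p).
Proof.
rewrite /bex bsumE lt0n sum_nat_eq0 negb_forall.
apply: (iffP existsP) => [[k]|[k ltkn pk]].
  by rewrite eqb0 negbK; exists k.
by exists (Ordinal ltkn); rewrite eqb0 negbK.
Qed.

Lemma bexR n h (p : nat -> seq nat -> bool) :
  crec n h -> crec n.+2 (fun s => p (x0 s) (behead (behead s))) ->
  crec n (fun s => bex (h s) (fun k => p k s)).
Proof.
by move=> hR pR; apply: ltnR; [apply: crec_const | apply: (bsumR hR pR)].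
Qed.

Definition ball n (p : nat -> bool) := ~~ bex n (fun k => ~~ p k).

Lemma ballP n (p : nat -> bool) :
  reflect (forall k, k < n -> p k) (ball n p).
Proof.
apply: (iffP idP) => [np k ltkn | allp].
  by apply: contraR np => npk; apply/bexP; exists k.
by apply/bexP => -[k ltkn]; rewrite allp.
Qed.

Lemma ballR n h (p : nat -> seq nat -> bool) :
  crec n h -> crec n.+2 (fun s => p (x0 s) (behead (behead s))) ->
  crec n (fun s => ball (h s) (fun k => p k s)).
Proof.
move=> hR pR; apply/negbR/(@bexR n h (fun k s => ~~ p k s)) => //.
exact: negbR.
Qed.

Ltac crec_step := lazymatch goal with
  | |- crec _ (fun _ => ?c) => apply: crec_const
  | |- crec _ (head 0) => var
  | |- crec _ (fun s => head 0 _) => var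
  | |- crec _ (fun s => nat_of_bool (ball _ _)) => apply: ballR
  | |- crec _ (fun s => nat_of_bool (bex _ _)) => apply: bexR
  | |- crec _ (fun s => nat_of_bool (_ && _)) => apply: andbR
  | |- crec _ (fun s => nat_of_bool (_ ==> _)) => apply: implybR
  | |- crec _ (fun s => nat_of_bool (leq _ _)) => apply: leqR
  | |- crec _ (fun s => nat_of_bool (_ == _)) => apply: eqnR
  | |- crec _ (fun s => bsum _ _) => apply: bsumR
  | |- crec _ (fun s => if _ then _ else _) => apply: ifR
  | |- crec _ (fun s => S _) => apply: succR
  | |- crec _ (fun s => addn _ _) => apply: addR
  | |- crec _ (fun s => subn _ _) => apply: subR
  | |- crec _ (fun s => muln _ _) => apply: mulR
  | |- crec _ (fun s => expn _ _) => apply: expR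
  | _ => assumption
  end.
Ltac crec := repeat crec_step.

(** Evaluates the searches below: quotient, 2-adic valuation and length are all obtained by counting
    the k below a threshold. *)
Lemma bsum_ltn n m : bsum n (fun k => k < m) = minn n m.
Proof.
elim: n => [|n]; first by rewrite min0n.
rewrite /bsum /= => ->; case: ltnP => [lt_nm | le_mn].
  by rewrite (minn_idPl lt_nm).
by rewrite (minn_idPr (leqW le_mn)).
Qed.

Lemma eq_bsum n f g : f =1 g -> bsum n f = bsum n g.
Proof. by move=> fg; rewrite !bsumE; apply: eq_bigr. Qed.

Lemma divR : crec2 divn.
Proof.
(* The quotient of m by d counts the k < m with (k + 1) d <= m; the conjunct [0 < x1 s] gives the
   value 0 at d = 0. *)
apply/crec2I/(crec_ext (F := fun s => bsum (x0 s)
    (fun k => (0 < x1 s) && (k.+1 * x1 s <= x0 s)))) => [s _|]; last by crec.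
move: (x0 s) (x1 s) => m [|d].
  by rewrite divn0 /= bsumE big1.
rewrite (eq_bsum _ (g := fun k => k < m %/ d.+1)) => [|k]; last first.
  by rewrite /= -leq_divRL.
by rewrite bsum_ltn; apply/minn_idPr/leq_div.
Qed.

(** * Codes of finite sequences *)

Definition ccons n m := 2 ^ n * m.*2.+1.

Lemma cconsR : crec2 ccons.
Proof.
apply/crec2I/(crec_ext (F := fun s => 2 ^ x0 s * (x1 s + x1 s).+1)) => [s _|].
  by rewrite addnn.
by crec.
Qed.

(* Head and tail of a sequence coded by CodeSeq.code, the head of
   2 ^ n * (2 * m + 1) being its 2-adic valuation n. *)
Definition chd c := bsum c (fun k => c %/ 2 ^ k.+1 * 2 ^ k.+1 == c).
Definition ctl c := c %/ 2 ^ (chd c).+1.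

Lemma chdR : crec1 chd.
Proof. by apply/crec1I; rewrite /chd; crec; apply: divR; crec. Qed.

Lemma ctlR : crec1 ctl.
Proof. by apply/crec1I; apply: divR; crec; apply: chdR; crec. Qed.

Lemma ltn_ccons n m : (n < ccons n m) && (m < ccons n m).
Proof.
have ltn2n : n < 2 ^ n by apply: ltn_expl.
rewrite (leq_trans ltn2n) ?leq_pmulr //= (@leq_trans m.*2.+1) //.
  by rewrite ltnS -addnn leq_addr.
by rewrite leq_pmull // expn_gt0.
Qed.

Lemma chd_cons n m : chd (ccons n m) = n.
Proof.
rewrite /chd (eq_bsum _ (g := fun k => k < n)) => [|k]; last first.
  (* [2 ^ k.+1] divides 2 ^ n (2 m + 1) exactly when k < n, the second factor being odd. *)
  rewrite -dvdn_eq /ccons pfactor_dvdn ?muln_gt0 ?expn_gt0 //.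
  by rewrite lognM ?expn_gt0 // pfactorK // lognE /= dvdn2 /= odd_double addn0.
by rewrite bsum_ltn; apply/minn_idPr; have /andP[/ltnW] := ltn_ccons n m.
Qed.

Lemma ctl_cons n m : ctl (ccons n m) = m.
Proof.
rewrite /ctl chd_cons /ccons expnS [2 * _]mulnC divnMA mulKn ?expn_gt0 //.
by rewrite divn2 /= uphalf_double.
Qed.

Notation code := CodeSeq.code.

Definition cdrop i c := iteri i (fun=> ctl) c.
Definition lnth c i := chd (cdrop i c).
(** Nonempty sequences have positive codes, and the length never exceeds the code, which therefore
    bounds the count. *)
Definition lsize c := bsum c (fun i => 0 < cdrop i c).

Lemma cdropR : crec2 cdrop.
Proof. by apply/crec2I/crec_iteri; crec; apply: ctlR; crec. Qed.

Lemma lnthR : crec2 lnth.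
Proof. by apply/crec2I/chdR/cdropR; crec. Qed.

Lemma lsizeR : crec1 lsize.
Proof. by apply/crec1I; rewrite /lsize; crec; apply: cdropR; crec. Qed.

Lemma cdrop_code i s : cdrop i (code s) = code (drop i s).
Proof.
elim: i => [|i IHi] /=; first by rewrite drop0.
rewrite IHi -add1n -drop_drop drop1; case: (drop i s) => [|x s'] //=.
exact: ctl_cons.
Qed.

Lemma lnth_code s i : lnth (code s) i = nth 0 s i.
Proof.
rewrite /lnth cdrop_code -[i in RHS]addn0 -nth_drop.
case: (drop i s) => //= x s'; exact: chd_cons.
Qed.

Lemma size_code s : size s <= code s.
Proof.
elim: s => //= x s IHs; apply: leq_ltn_trans IHs _.
by have /andP[] := ltn_ccons x (code s).
Qed.

Lemma lsize_code s : lsize (code s) = size s.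
Proof.
rewrite /lsize (eq_bsum _ (g := fun i => i < size s)) => [|i].
  by rewrite bsum_ltn; apply/minn_idPr/size_code.
rewrite cdrop_code -[i < _]subn_gt0 -size_drop; case: (drop i s) => //= x s'.
by rewrite muln_gt0 expn_gt0.
Qed.

(** Built from the last entry backwards, since [ccons] adds at the front: hence the argument
    [n - k.+1]. *)
Definition mkl n f := iteri n (fun k => ccons (f (n - k.+1))) 0.

Lemma mklE n f : mkl n f = code (mkseq f n).
Proof.
suffices itE k : k <= n ->
    iteri k (fun k => ccons (f (n - k.+1))) 0 = code (map f (iota (n - k) k)).
  by rewrite /mkl itE // subnn.
by elim: k => //= k IHk ltkn; rewrite IHk 1?ltnW // subnSK.
Qed.

Lemma lnth_mkl n f i : i < n -> lnth (mkl n f) i = f i.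
Proof. by move=> ltin; rewrite mklE lnth_code nth_mkseq. Qed.

Lemma eq_mkl n f g : (forall i, i < n -> f i = g i) -> mkl n f = mkl n g.
Proof.
move=> fg; rewrite !mklE; congr code; apply/eq_in_map => i.
by rewrite mem_iota => /fg.
Qed.

(** For [mkl], whose body is evaluated at [n - k.+1] rather than at the counter. The body is
    composed with [e], a dummy 0 for the accumulator, and projections. *)
Lemma crec_subst n (f : nat -> seq nat -> nat) e :
    crec n.+2 (fun s => f (x0 s) (behead (behead s))) -> crec n.+2 e ->
  crec n.+2 (fun s => f (e s) (behead (behead s))).
Proof.
move=> fR eR; pose gs := e :: (fun=> 0) :: [seq (nth 0)^~ i.+2 | i <- iota 0 n].
have size_gs : size gs = n.+2 by rewrite /= size_map size_iota.
rewrite -{1}size_gs in fR.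
apply: crec_ext (crec_comp fR (_ : forall i, _ -> crec n.+2 _)) => [|[|[|i]]] //=.
- case=> [|a [|b s]] //= [sz_s]; congr f.
  by rewrite -map_comp -[RHS](mkseq_nth 0) sz_s.
- by move=> _; apply: crec_const.
rewrite size_map size_iota !ltnS => lt_in.
rewrite (nth_map 0) ?size_iota // nth_iota //; exact: crec_nth.
Qed.

Lemma crec_weak n f : crec n f -> crec n.+2 (fun s => f (behead (behead s))).
Proof.
move=> fR; pose gs := [seq (nth 0)^~ i.+2 | i <- iota 0 n].
have size_gs : size gs = n by rewrite /= size_map size_iota.
rewrite -{1}size_gs in fR.
apply: crec_ext (crec_comp fR (_ : forall i, _ -> crec n.+2 _)) => [|i] /=.
  case=> [|a [|b s]] //= [sz_s]; congr f.
  by rewrite -map_comp -[RHS](mkseq_nth 0) sz_s.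
rewrite size_map size_iota => lt_in.
rewrite (nth_map 0) ?size_iota // nth_iota //; exact: crec_nth.
Qed.

Lemma mklR n h (f : nat -> seq nat -> nat) :
  crec n h -> crec n.+2 (fun s => f (x0 s) (behead (behead s))) ->
  crec n (fun s => mkl (h s) (fun k => f k s)).
Proof.
move=> hR fR.
apply: (@crec_iteri n h (fun=> 0) (fun k r s => ccons (f (h s - k.+1) s) r)) => //.
  exact: crec_const.
apply: cconsR; last by var.
by apply: (crec_subst fR); apply: subR (crec_weak hR) _; crec.
Qed.

(** * The solver *)

(* The components of c = pickle S for S : finspace. *)
Definition cnu c := lnth (lnth c 0) 0.
Definition clab c := lnth (lnth c 0) 1.
Definition cedges c := lnth c 1.
Definition nvert c := lsize (clab c).
Definition neqs c := lsize (cnu c).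

(* ccons k 0 and 0 are the codes of the labels Some k and None. *)
Definition has_label c m k := lnth (clab c) m == ccons k 0.
(** The code of the edge list bounds its length; positions past the end read as 0, which is not the
    code of a pair. *)
Definition edgeb c m m' :=
  bex (cedges c) (fun i => lnth (cedges c) i == ccons m (ccons m' 0)).
Definition holds c A m :=
  bex (nvert c) (fun m' => edgeb c m m' &&
    ball (nvert c) (fun m'' => edgeb c m' m'' ==> (lnth A m'' == 1))).

(* A set A of vertices is coded by the sequence of its characteristic values.
   Solving the equation k for the parameters A, the inner equations being
   solved by g, iterates step and replaces in A the vertices labelled k. *)
Definition step c k A B :=
  mkl (nvert c) (fun m => if has_label c m k then holds c B m : nat else lnth A m).
(** The sign bit doubles as characteristic value: the iteration starts from all vertices labelled k
    for nu, from none for mu. *)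
Definition start c k A :=
  mkl (nvert c) (fun m => if has_label c m k then lnth (cnu c) k else lnth A m).
Definition solve_eq c (g : nat -> nat) k A :=
  g (iteri (nvert c).+1 (fun=> fun Q => step c k A (g Q)) (start c k A)).

(* The code of the graph of nested c j below; codes of sets of vertices are
   smaller than 4 ^ nvert c. *)
Definition table c j :=
  iteri j (fun k r => mkl (4 ^ nvert c) (fun A => solve_eq c (lnth r) (neqs c - k.+1) A))
    (mkl (4 ^ nvert c) id).

Definition solve c m := lnth (lnth (table c (neqs c)) (mkl (nvert c) (fun=> 0))) m.

(** * Recursiveness of the solver *)

Lemma cnuR : crec1 cnu.
Proof. by move=> n f fR; apply: lnthR; crec; apply: lnthR; crec. Qed.

Lemma clabR : crec1 clab.
Proof. by move=> n f fR; apply: lnthR; crec; apply: lnthR; crec. Qed.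

Lemma cedgesR : crec1 cedges.
Proof. by move=> n f fR; apply: lnthR; crec. Qed.

Lemma nvertR : crec1 nvert.
Proof. by move=> n f fR; apply/lsizeR/clabR. Qed.

Lemma neqsR : crec1 neqs.
Proof. by move=> n f fR; apply/lsizeR/cnuR. Qed.

Lemma has_labelR : crec3 has_label.
Proof. by apply/crec3I/eqnR; [apply: lnthR | apply: cconsR]; crec; apply: clabR; crec. Qed.

Lemma edgebR : crec3 edgeb.
Proof.
apply/crec3I/bexR; first by apply: cedgesR; crec.
apply: eqnR; first by apply: lnthR; [apply: cedgesR|]; crec.
by apply: cconsR; [|apply: cconsR]; crec.
Qed.

Lemma holdsR : crec3 holds.
Proof.
apply/crec3I; rewrite /holds; crec; try by apply: nvertR; crec.
- by apply: edgebR; crec.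
- by apply: edgebR; crec.
by apply: lnthR; crec.
Qed.

Lemma stepR : crec4 step.
Proof.
apply/crec4I/mklR; first by apply: nvertR; crec.
apply: ifR; [apply: has_labelR | apply: holdsR | apply: lnthR]; crec.
Qed.

Lemma startR : crec3 start.
Proof.
apply/crec3I/mklR; first by apply: nvertR; crec.
apply: ifR; [apply: has_labelR | apply: lnthR | apply: lnthR]; crec.
by apply: cnuR; crec.
Qed.

(** With the inner solver given by the code [r] of its table, all arguments are numbers, so that
    [table] is a primitive recursion. *)
Lemma solve_eqR : crec4 (fun c r k A => solve_eq c (lnth r) k A).
Proof.
apply/crec4I/lnthR; crec; apply: crec_iteri; first by apply/succR/nvertR; crec.
- by apply: startR; crec.
by apply: stepR; crec; apply: lnthR; crec.
Qed.

Lemma tableR : crec2 table.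
Proof.
apply/crec2I/crec_iteri; crec.
  by apply: mklR; crec; apply: nvertR; crec.
apply: mklR; crec; first by apply: nvertR; crec.
by apply: solve_eqR; crec; apply: neqsR; crec.
Qed.

Lemma solveR : crec2 solve.
Proof.
apply/crec2I; apply: lnthR; crec; apply: lnthR.
  by apply: tableR; crec; apply: neqsR; crec.
by apply: mklR; crec; apply: nvertR; crec.
Qed.

(** * Semantics *)

Definition vset c A := exists p : nat -> bool, A = mkl (nvert c) p.

(** A Boolean head b turns a code m into 2 ^ b (2 m + 1) <= 2 (2 m + 1) < 4 (m + 1): each entry
    costs at most a factor 4. *)
Lemma vset_ltn c A : vset c A -> A < 4 ^ nvert c.
Proof.
case=> p ->; rewrite mklE -[X in _ ^ X](size_mkseq p) /mkseq map_comp.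
elim: (map p _) => //= b s IHs; set m := code _ in IHs *.
apply: (@leq_trans (4 * m.+1)); last by rewrite expnS leq_mul2l.
apply: (@leq_ltn_trans (2 * m.*2.+1)); last first.
  by rewrite -mul2n !mulnS mulnA ltn_add2r.
by rewrite leq_mul2r (leq_pexp2l (n2 := 1)) ?orbT //; case: (b).
Qed.

Lemma lnth_vset c A m : vset c A -> m < nvert c -> lnth A m = (lnth A m == 1).
Proof. by case=> p -> ltmN; rewrite lnth_mkl //; case: (p m). Qed.

(** The function that [table] tabulates. Here the function [nested c j'] itself is passed to the
    iteration: the recursion is on functions, not on numbers. *)
Fixpoint nested c j A :=
  if j is j'.+1 then solve_eq c (nested c j') (neqs c - j) A else A.

Section Nested.
Variable c : nat.
Hypothesis nu_bool : forall k, lnth (cnu c) k <= 1.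

Lemma vset_start k A : vset c A -> vset c (start c k A).
Proof.
move=> Av; exists (fun m => if has_label c m k then lnth (cnu c) k == 1 else lnth A m == 1).
apply: eq_mkl => m ltmN; case: has_label; last exact: lnth_vset Av _.
by case: (lnth _ k) (nu_bool k) => [|[]].
Qed.

Lemma vset_step k A B : vset c A -> vset c (step c k A B).
Proof.
move=> Av; exists (fun m => if has_label c m k then holds c B m else lnth A m == 1).
by apply: eq_mkl => m ltmN; case: has_label; last exact: lnth_vset Av _.
Qed.

Lemma vset_iter g k A t :
  vset c A -> vset c (iteri t (fun=> fun Q => step c k A (g Q)) (start c k A)).
Proof. by case: t => [|t] Av; [apply: vset_start | apply: vset_step]. Qed.

Lemma vset_nested j A : vset c A -> vset c (nested c j A).
Proof. by elim: j A => //= j IHj A Av; apply/IHj/vset_iter. Qed.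

(** Every argument at which the previous table is read is again a [vset], hence within its range. *)
Lemma table_nested j A : vset c A -> lnth (table c j) A = nested c j A.
Proof.
elim: j A => [|j IHj] A Av /=; first by rewrite lnth_mkl // vset_ltn.
rewrite lnth_mkl ?vset_ltn // /solve_eq.
rewrite IHj; last by case: _.+1 => [|t]; [apply: vset_start | apply: vset_step].
congr nested; elim: _.+1 => // t IHt; rewrite !iteriS IHt; congr step.
by apply: IHj; apply: vset_iter.
Qed.

End Nested.

(** * Stationary chains and fixed points by iteration *)

Local Open Scope classical_set_scope.

(** By saturation, a new element brings a new class, so a strict step enlarges the image of [P t] in
    ['I_N]; N + 1 strict steps would exceed its cardinality. *)
Lemma chain_stationary (T : Type) (N : nat) (cl : T -> nat) (P : nat -> set T) :
    (forall v, cl v < N) -> (forall t, P t `<=` P t.+1) ->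
    (forall t v w, cl v = cl w -> P t v -> P t w) ->
  exists2 t, t <= N & P t.+1 = P t.
Proof.
move=> clN Pincr Psat.
pose img t := [pred m : 'I_N | `[<exists2 v, cl v = m & P t v>]].
have [//|Pstrict] := pselect (exists2 t, t <= N & P t.+1 = P t).
suffices lt_img t : t <= N.+1 -> t <= #|img t|.
  by have := leq_trans (lt_img _ (leqnn _)) (max_card _); rewrite card_ord ltnn.
elim: t => // t IHt ltN; apply: leq_ltn_trans (IHt (ltnW ltN)) _.
apply/proper_card/properP; split.
  apply/fintype.subsetP => m /asboolP[v vm Pv]; apply/asboolP.
  by exists v => //; apply: Pincr.
have [v [Pv nPv]] : exists v, P t.+1 v /\ ~ P t v.
  apply: contrapT => noex; case: Pstrict; exists t => //.
  apply/seteqP; split=> [v Pv|]; last exact: Pincr.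
  by apply: contrapT => nPv; apply: noex; exists v.
exists (Ordinal (clN v)); first by apply/asboolP; exists v.
apply/negP => /asboolP[w clw Pw]; exact: nPv (Psat _ _ _ clw Pw).
Qed.

Section FixedPoints.
Variables (T : Type) (N : nat) (cl : T -> nat) (F : set T -> set T).
Hypothesis clN : forall v, cl v < N.
Hypothesis F_mono : forall P Q, P `<=` Q -> F P `<=` F Q.

(** Iterates from the empty set lie below every pre-fixed point, and the stationary one is itself
    pre-fixed. *)
Lemma lfp_iter :
    (forall t v w, cl v = cl w -> iter t F set0 v -> iter t F set0 w) ->
  lfp F = iter N.+1 F set0.
Proof.
move=> sat.
have incr t : iter t F set0 `<=` iter t.+1 F set0.
  by elim: t => [|t IHt] //; apply: F_mono.
have [t letN fixt] := chain_stationary clN incr sat.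
have -> : iter N.+1 F set0 = iter t F set0.
  by rewrite -(subnK (leqW letN)) iterD iter_fix.
apply/seteqP; split=> [v|]; first by apply; rewrite /= -iterS fixt.
elim: {fixt letN} t => [v []|t IHt v Fv P FP].
by apply: (FP); apply: F_mono Fv => w /IHt; apply.
Qed.

Lemma gfp_iter :
    (forall t v w, cl v = cl w -> iter t F setT v -> iter t F setT w) ->
  gfp F = iter N.+1 F setT.
Proof.
move=> sat.
have decr t : iter t.+1 F setT `<=` iter t F setT.
  by elim: t => [|t IHt] //; apply: F_mono.
(* The complements of the decreasing iterates form an increasing saturated chain. *)
have [|t v w clvw nv wv|t letN fixt] :=
    chain_stationary (P := fun t => ~` iter t F setT) clN.
- by move=> t; apply: subsetC.
- by apply: nv; apply: sat wv.
move/(congr1 setC): fixt; rewrite !setCK => fixt.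
have -> : iter N.+1 F setT = iter t F setT.
  by rewrite -(subnK (leqW letN)) iterD iter_fix.
apply/seteqP; split=> [v [P FP Pv]|v tv]; last first.
  by exists (iter t F setT) => //; rewrite /= -iterS fixt.
suff : P `<=` iter t F setT by apply.
elim: {fixt letN} t => [|t IHt] // w /FP; exact: F_mono.
Qed.

End FixedPoints.

(** * Monotonicity of the semantics *)

Section Monotonicity.
Variables (T : Type) (E : epbes T).

Lemma rhs_mono i (eta eta' : env E) :
  (forall j, eta j `<=` eta' j) -> rhs i eta `<=` rhs i eta'.
Proof.
move=> le v [k [e [gv etav]]]; exists k, e; split=> // j; exact/le/etav.
Qed.

Lemma upd_mono i (eta eta' : env E) P P' :
    (forall j, eta j `<=` eta' j) -> P `<=` P' ->
  forall j, upd eta i P j `<=` upd eta' i P' j.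
Proof. by move=> le leP j; rewrite /upd; case: eqP. Qed.

(** Post-fixed points of an operator remain so for a larger one, and pre-fixed points for a smaller
    one; hence both fixed points are monotone in the operator. *)
Lemma solve_eqs_mono s (eta eta' : env E) :
  (forall j, eta j `<=` eta' j) ->
  forall j, solve_eqs s eta j `<=` solve_eqs s eta' j.
Proof.
elim: s eta eta' => //= i s IHs eta eta' le; apply/IHs/upd_mono => //.
have leF P : rhs i (solve_eqs s (upd eta i P)) `<=` rhs i (solve_eqs s (upd eta' i P)).
  by apply/rhs_mono/IHs/upd_mono.
case: ifP => _ v.
  by case=> P leP Pv; exists P => //; apply: subset_trans leP (leF P).
by move=> lfpv P leP; apply: lfpv; apply: subset_trans (leF P) leP.
Qed.

End Monotonicity.

(** * Correctness of the solver *)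

Section Correctness.
Variables (T : countType) (E : epbes T).
Variables (simD : equiv_rel (orv E)) (simB : equiv_rel (andv E)).
Hypothesis feas : feasible simD simB.
Variables (S : finspace) (num : rvertex simD simB -> nat).
Hypothesis repS : represents S num.

Let c := pickle S.
Let cl (x : vertex E) := num (\pi x).

Lemma cnu_pickle : cnu c = code (map nat_of_bool (fs_isnu S)).
Proof.
(* By computation: a pair is pickled as the code of the sequence of its two pickled components. *)
have c0 : lnth c 0 = code [:: pickle (fs_isnu S); pickle (fs_label S)].
  exact: (lnth_code [:: _; _] 0).
by rewrite /cnu c0 lnth_code.
Qed.

Lemma clab_pickle : clab c = code (map pickle (fs_label S)).
Proof.
have c0 : lnth c 0 = code [:: pickle (fs_isnu S); pickle (fs_label S)].
  exact: (lnth_code [:: _; _] 0).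
by rewrite /clab c0 lnth_code.
Qed.

Lemma cedges_pickle : cedges c = code (map pickle (fs_edges S)).
Proof. exact: (lnth_code [:: _; _] 1). Qed.

Lemma nvert_pickle : nvert c = size (fs_label S).
Proof. by rewrite /nvert clab_pickle lsize_code size_map. Qed.

Lemma neqs_pickle : neqs c = nvar E.
Proof.
case: repS => _ _ isnuS _ _.
by rewrite /neqs cnu_pickle lsize_code size_map isnuS size_map size_enum_ord.
Qed.

Lemma lnth_cnu (i : 'I_(nvar E)) : lnth (cnu c) i = isnu i.
Proof.
case: repS => _ _ isnuS _ _.
rewrite cnu_pickle lnth_code isnuS -map_comp (nth_map i) ?size_enum_ord //=.
by rewrite nth_ord_enum.
Qed.

Lemma lnth_cnu_le1 k : lnth (cnu c) k <= 1.
Proof.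
rewrite cnu_pickle lnth_code; have [ltk | lek] := ltnP k (size (fs_isnu S)).
  by rewrite (nth_map false) // leq_b1.
by rewrite nth_default // size_map.
Qed.

Lemma cl_ltn x : cl x < nvert c.
Proof.
case: repS => _ rangeS _ _ _; rewrite nvert_pickle.
suff : [set m | m < size (fs_label S)] (cl x) by [].
by rewrite -rangeS; exists (\pi x).
Qed.

Lemma has_label_cl x (i : 'I_(nvar E)) :
  has_label c (cl x) i = (label x == Some (val i)).
Proof.
case: repS => _ _ _ <- _; have := cl_ltn x; rewrite nvert_pickle -/(cl x).
rewrite /has_label clab_pickle lnth_code => ltx; rewrite (nth_map None) //.
exact: (inj_eq (pcan_inj pickleK) _ (Some (val i))).
Qed.

Lemma edgebP m m' :
  reflect (exists x y, [/\ edge x y, cl x = m & cl y = m']) (edgeb c m m').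
Proof.
case: repS => num_inj _ _ _ edgeS.
have -> : edgeb c m m' = ((m, m') \in fs_edges S).
  rewrite /edgeb cedges_pickle; apply/bexP/idP => [[i lti]|].
    rewrite lnth_code; have [lt_i | le_i] := ltnP i (size (fs_edges S)); last first.
      by rewrite nth_default ?size_map // eq_sym muln_eq0 expn_eq0.
    rewrite (nth_map (0, 0)) //.
    rewrite -[ccons m _]/(pickle (m, m')) => /eqP/(pcan_inj pickleK) <-.
    exact: mem_nth.
  move=> mm'E; have lti : index (m, m') (fs_edges S) < size (fs_edges S).
    by rewrite index_mem.
  exists (index (m, m') (fs_edges S)).
    by apply: leq_trans lti _; rewrite -(size_map pickle) size_code.
  by rewrite lnth_code (nth_map (0, 0)) // nth_index.
apply: (iffP idP) => [/edgeS[_ [_ [[x [y [xy <- <-]]] <- <-]]]|].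
  by exists x, y.
case=> x [y [xy <- <-]]; apply/edgeS; exists (\pi x), (\pi y); split=> //.
by exists x, y.
Qed.

Lemma cl_or (q q' : orv E) : cl (inl q) = cl (inl q') -> simD q q'.
Proof. by case: repS => num_inj _ _ _ _ /num_inj/eqmodP. Qed.

Lemma cl_and (b b' : andv E) : cl (inr b) = cl (inr b') -> simB b b'.
Proof. by case: repS => num_inj _ _ _ _ /num_inj/eqmodP. Qed.

Lemma cl_inl_inr (q : orv E) (b : andv E) : cl (inl q) <> cl (inr b).
Proof. by case: repS => num_inj _ _ _ _ /num_inj/eqmodP. Qed.

Lemma or_cl (q q' : orv E) : simD q q' -> cl (inl q) = cl (inl q').
Proof. by move=> qq'; congr num; apply/eqmodP. Qed.

Lemma and_cl (b b' : andv E) : simB b b' -> cl (inr b) = cl (inr b').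
Proof. by move=> bb'; congr num; apply/eqmodP. Qed.

(** This forces [eta] to be saturated, the right-hand side depending only on the class of [q]. *)
Definition agrees (eta : env E) A :=
  forall q : orv E, eta q.1 q.2 <-> lnth A (cl (inl q)) = 1.

(** A reduced edge only relates some representatives of its ends; the two directions use the
    transfer clauses of feasibility for [Gset] and [Fset] respectively. *)
Lemma agrees_rhs (eta : env E) A (q : orv E) : agrees eta A ->
  rhs q.1 eta q.2 <-> holds c A (cl (inl q)).
Proof.
case: q => i v etaA; have [D1 D2 B1 B2] := feas; split=> /=.
  case=> k [e]; set cc : clause E := Tagged _ k => -[gve etaj].
  apply/bexP; exists (cl (inr (cc, v, e))); first exact: cl_ltn.
  apply/andP; split.
    by apply/edgebP; exists (inl (i, v)), (inr (cc, v, e)).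
  apply/ballP => m ltm; apply/implyP => /edgebP[x [y [xy xcc ym]]].
  case: x y xy xcc ym => [[? ?]|[[c' v'] w']] [?|[[? ?] ?]] //=.
    by move=> _ /cl_inl_inr.
  move=> [g' [j ->]] /cl_and simcc <-.
  have Ecc : c' = cc by apply: contrapT => /B1; apply; exact: simcc.
  move: (Ecc) => Ecc'; subst c'.
  (* The edge may start at another representative [(cc, v', w')]; its target is matched with a
     successor of [(cc, v, e)], to which [etaj] applies. *)
  set q' := (X in cl (inl X)); have /seteqP[subG _] := B2 _ _ _ _ _ simcc.
  have [|q'' [_ [j' ->]] /eqmodP simq] := subG (\pi q').
    by exists q' => //; split=> //; exists j.
  by rewrite -(or_cl simq); apply/eqP/(etaA (_, _)); apply: etaj.
move/bexP => [m _ /andP[/edgebP[x [y [xy clx <-]]] /ballP ally]].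
case: x y xy clx ally => [[i' v']|[[? ?] ?]] [?|[[c' v''] w]] //=; last first.
  by move=> _ /esym/cl_inl_inr.
move=> [tagc -> {v''} gv'w] /cl_or simq ally.
have Ei : i' = i by apply: contrapT => /D1; apply; exact: simq.
case: c' tagc gv'w ally => i'' k /= tagc; rewrite Ei in simq tagc; subst i''.
set cc : clause E := existT _ i k => gv'w ally.
(* The edge may start at an equivalent X_i(v'); X_i(v) then has a successor [(cc, v, w')] equivalent
   to [b], so [ally] covers the successors of that vertex. *)
pose b := (cc, v', w); have /seteqP[subF _] := D2 _ _ _ simq k.
have [|_ [_ [w' [gvw' ->]]] /eqmodP /= simb] := subF (\pi b).
  by exists b => //; split=> //; exists w.
exists k, w'; split=> // j; apply/(etaA (_, _)).
have clj := cl_ltn (inl (target j, arg j v w')).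
move/implyP: (ally _ clj) => /(_ _)/eqP; apply.
apply/edgebP; exists (inr (cc, v, w')), (inl (target j, arg j v w')).
split=> //; last exact: and_cl.
by split=> //; exists j.
Qed.

Lemma agrees_step (eta : env E) (i : 'I_(nvar E)) A (eta' : env E) B :
    agrees eta A -> vset c A -> agrees eta' B ->
  agrees (upd eta i (rhs i eta')) (step c i A B).
Proof.
move=> etaA Av etaB q; rewrite lnth_mkl ?cl_ltn // has_label_cl /upd.
case: q => i' v; rewrite /= (inj_eq (@Some_inj _)) -[_ == _ :> nat]/(i' == i).
case: eqP => [->|_]; last exact: (etaA (_, _)).
rewrite (agrees_rhs (i, v) etaB) /=; by case: holds.
Qed.

Lemma agrees_start (eta : env E) (i : 'I_(nvar E)) A :
    agrees eta A ->
  agrees (upd eta i (if isnu i then setT else set0)) (start c i A).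
Proof.
move=> etaA q; rewrite lnth_mkl ?cl_ltn // has_label_cl /upd.
case: q => i' v; rewrite /= (inj_eq (@Some_inj _)) -[_ == _ :> nat]/(i' == i).
case: eqP => _; last exact: (etaA (_, _)).
by rewrite lnth_cnu; case: isnu.
Qed.

Lemma agrees_nested j (eta : env E) A :
    j <= nvar E -> agrees eta A -> vset c A ->
  agrees (solve_eqs (drop (nvar E - j) (enum 'I_(nvar E))) eta) (nested c j A).
Proof.
elim: j eta A => [|j IHj] eta A lej etaA Av.
  by rewrite subn0 drop_oversize ?size_enum_ord.
(* This is the index of the equation heading the last j + 1 ones. *)
have ltn : nvar E - j.+1 < nvar E by rewrite ltn_subrL (leq_ltn_trans _ lej).
pose i := Ordinal ltn.
rewrite (drop_nth i) ?size_enum_ord // (nth_ord_enum i i) /= subnSK //.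
rewrite neqs_pickle -[nvar E - j.+1]/(val i).
set s := drop _ _ in IHj *; set F := fun P => _.
set P0 := if isnu i then setT else set0 : set T.
(* The coded iteration follows the iterates of [F]; this also yields their saturation, required to
   reach the fixed point in finitely many steps. *)
have agreesF t : agrees (upd eta i (iter t F P0))
    (iteri t (fun=> fun Q => step c i A (nested c j Q)) (start c i A)).
  elim: t => [|t IHt] /=; first exact: agrees_start.
  apply: agrees_step => //; apply: IHj => //; first exact: ltnW.
  exact/vset_iter/Av/lnth_cnu_le1.
have F_mono P Q : P `<=` Q -> F P `<=` F Q.
  by move=> lePQ; apply/rhs_mono; apply: solve_eqs_mono; apply: upd_mono => // ? ?.
have satF t v w : cl (inl (i, v)) = cl (inl (i, w)) ->
    iter t F P0 v -> iter t F P0 w.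
  move=> vw; have := agreesF t (i, v); have := agreesF t (i, w).
  by rewrite /upd /= eqxx vw => <- <-.
have clN v : cl (inl (i, v)) < nvert c by exact: cl_ltn.
have -> : (if isnu i then gfp F else lfp F) = iter (nvert c).+1 F P0.
  rewrite /P0 in satF *; case: isnu satF => satF.
    exact: gfp_iter clN F_mono satF.
  exact: lfp_iter clN F_mono satF.
apply: IHj; [exact: ltnW | exact: agreesF |].
exact/vset_iter/Av/lnth_cnu_le1.
Qed.

(** The bound by 1 makes the answer 0 whenever membership fails. *)
Lemma solve_membership (q : orv E) :
  (membership q <-> solve c (cl (inl q)) = 1) /\ solve c (cl (inl q)) <= 1.
Proof.
have Av : vset c (mkl (nvert c) (fun=> 0)) by exists (fun=> false).
have := agrees_nested (leqnn _) (_ : agrees (fun=> set0) _) Av.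
rewrite subnn drop0 /solve neqs_pickle (table_nested lnth_cnu_le1) //.
move=> agr; split; first by apply: agr => -[i v]; rewrite lnth_mkl ?cl_ltn.
rewrite (lnth_vset (vset_nested lnth_cnu_le1 _ Av) (cl_ltn _)); exact: leq_b1.
Qed.

End Correctness.

(* [solve] takes the finite reduced dependency space [S] and the number of a
   vertex; [loc] computes the number of the class of a given X_i(v). *)
Theorem theorem2 :
  exists2 solve : nat -> nat -> nat, recursive2 solve &
  forall (T : countType) (E : epbes T)
    (simD : equiv_rel (orv E)) (simB : equiv_rel (andv E)),
  feasible simD simB ->
  forall (S : finspace) (num : rvertex simD simB -> nat),
  represents S num ->
  forall loc : nat -> nat,
  recursive1 loc ->
  (forall q : orv E, loc (pickle q) = num (\pi_(rvertex simD simB) (inl q))) ->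
  decides (fun x => solve (pickle S) (loc x)) (@membership T E).
Proof.
exists solve; first exact/crec2_recursive2/solveR.
move=> T E simD simB feas S num repS loc locR locE; split.
  (* The code of [S] enters as a constant; [solve] itself is uniform in [S]. *)
  apply: crec1_recursive1 => n f fR; apply: solveR; first exact: crec_const.
  exact: recursive1_crec1.
move=> q; rewrite locE; have [memq] := solve_membership feas repS q.
by case: solve memq => [|[]] // memq; split=> // /memq.
Qed.
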